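(* Let $a,b,c$ be positive integers such that $H=\langle a,b,c\rangle$ is a numerical semigroup that is not symmetric. Let $k$ be a field, and suppose that $\alpha,\beta,\gamma,\alpha',\beta',\gamma'$ are positive integers such that the kernel of the $k$-algebra homomorphism $\varphi:k[X,Y,Z]\to k[t]$, $\varphi(X)=t^a$, $\varphi(Y)=t^b$, $\varphi(Z)=t^c$, is the ideal generated by the maximal minors of the matrix $$\begin{pmatrix} X^{\alpha} & Y^{\beta} & Z^{\gamma}\\ Y^{\beta'} & Z^{\gamma'} & X^{\alpha'}\end{pmatrix}.$$ Then: (1) if $\beta' b>\alpha a$, then $2\,\mathrm{g}(H)-(\mathrm{F}(H)+1)=\alpha\beta\gamma$; (2) if $\beta' b<\alpha a$, then $2\,\mathrm{g}(H)-(\mathrm{F}(H)+1)=\alpha'\beta'\gamma'$.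
   Context: $\mathbb{N}$ is the set of nonnegative integers. A numerical semigroup $H$ is a subset of $\mathbb{N}$ containing $0$, closed under addition, with $\mathbb{N}\setminus H$ finite; $\langle a_1,\dots,a_n\rangle=\sum_{i=1}^n a_i\mathbb{N}$. The Frobenius number is $\mathrm{F}(H)=\max\{n\in\mathbb{Z}\mid n\notin H\}$ and the genus is $\mathrm{g}(H)=\mathrm{Card}(\mathbb{N}\setminus H)$. $H$ is symmetric if $\mathrm{F}(H)$ is odd and for every $x\in\mathbb{Z}$ either $x\in H$ or $\mathrm{F}(H)-x\in H$ (equivalently $2\mathrm{g}(H)=\mathrm{F}(H)+1$). For every non-symmetric $H=\langle a,b,c\rangle$ it is known (Herzog) that the kernel of $\varphi$ is generated by the maximal minors of a matrix of the stated form for some positive integers $\alpha,\beta,\gamma,\alpha',\beta',\gamma'$. *)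

(* Defs.v *)
From mathcomp Require Import all_boot all_order all_algebra.
From mathcomp Require Import mpoly.
From Stdlib Require Import ClassicalEpsilon.

Set Implicit Arguments.
Unset Strict Implicit.
Unset Printing Implicit Defensive.

Import Order.TTheory GRing.Theory Num.Theory.
Local Open Scope ring_scope.

Definition semigroup_gen (s : seq nat) (n : nat) : Prop :=
  exists x : 'I_(size s) -> nat, n = (\sum_i x i * nth 0 s i)%N.

Definition numerical_semigroup (H : nat -> Prop) : Prop :=
  [/\ H 0%N,
      forall m n, H m -> H n -> H (m + n)%N
    & exists s : seq nat, forall n, ~ H n -> n \in s].

Definition int_mem (H : nat -> Prop) (x : int) : Prop :=
  exists2 n : nat, x = n%:Z & H n.

Definition is_frobenius (H : nat -> Prop) (F : int) : Prop :=
  ~ int_mem H F /\ forall x, ~ int_mem H x -> x <= F.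

Definition is_genus (H : nat -> Prop) (g : nat) : Prop :=
  exists s : seq nat, [/\ uniq s, forall n, n \in s <-> ~ H n & size s = g].

(* The default values are irrelevant for numerical semigroups: see
   frobeniusP and genusP. *)
Definition frobenius (H : nat -> Prop) : int :=
  epsilon (inhabits (0 : int)) (is_frobenius H).

Definition genus (H : nat -> Prop) : nat :=
  epsilon (inhabits 0%N) (is_genus H).

Definition symmetric_semigroup (H : nat -> Prop) : Prop :=
  ~~ (2 %| frobenius H)%Z
  /\ forall x : int, int_mem H x \/ int_mem H (frobenius H - x).

Definition ideal_gen (R : comNzRingType) (I : finType) (g : I -> R) (p : R) :
    Prop :=
  exists u : I -> R, p = \sum_i u i * g i.

(* Deleting one column of a matrix with two rows and three columns leaves a
   square matrix, so these are all the maximal minors. *)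
Definition max_minor (R : comNzRingType) (M : 'M[R]_(2, 3)) (j : 'I_3) : R :=
  \det (col' j M : 'M[R]_2).

Section MonomialCurve.
Variable k : fieldType.

Definition varX : {mpoly k[3]} := 'X_(@Ordinal 3 0 isT).
Definition varY : {mpoly k[3]} := 'X_(@Ordinal 3 1 isT).
Definition varZ : {mpoly k[3]} := 'X_(@Ordinal 3 2 isT).

Definition phi (a b c : nat) (p : {mpoly k[3]}) : {poly k} :=
  mmap (@polyC k) (fun i : 'I_3 => 'X^(nth 0%N [:: a; b; c] i)) p.

Definition herzog_matrix (al be ga al' be' ga' : nat) :
    'M[{mpoly k[3]}]_(2, 3) :=
  \matrix_(i < 2, j < 3)
    nth 0 (nth [::] [:: [:: varX ^+ al;  varY ^+ be;  varZ ^+ ga ];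
                        [:: varY ^+ be'; varZ ^+ ga'; varX ^+ al']] i) j.

End MonomialCurve.

Lemma is_frobenius_uniq H F1 F2 :
  is_frobenius H F1 -> is_frobenius H F2 -> F1 = F2.
Proof.
by move=> [n1 m1] [n2 m2]; apply/eqP; rewrite eq_le m1 // m2.
Qed.

Lemma is_genus_uniq H g1 g2 : is_genus H g1 -> is_genus H g2 -> g1 = g2.
Proof.
move=> [s1 [u1 h1 <-]] [s2 [u2 h2 <-]].
apply: perm_size; apply: uniq_perm => // n.
by apply/idP/idP => [/h1 /h2 | /h2 /h1].
Qed.

Lemma frobeniusP H : numerical_semigroup H -> is_frobenius H (frobenius H).
Proof.
move=> [_ _ [s hs]]; apply: epsilon_spec.
have [N hN] : exists N, forall n, (N <= n)%N -> H n.
  exists (\max_(i <- s) i).+1 => n ltn; apply: NNPP => /hs ns.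
  by move: ltn; rewrite ltnNge (@leq_bigmax_seq _ s xpredT (fun i => i) n ns isT).
elim: N hN => [|N IH] hN.
  exists (-1); split=> [[] // | [m | m] hx].
    by case: hx; exists m => //; apply: hN.
  by rewrite NegzE lerN2 lez_nat.
have [HN | nHN] := classic (H N).
  by apply: IH => n; rewrite leq_eqVlt => /orP[/eqP <- // | /hN].
exists N%:Z; split=> [[m [<-]] // | [m | m] hx //].
rewrite lez_nat leqNgt; apply/negP => /hN Hm.
by apply: hx; exists m.
Qed.

Lemma genusP H : numerical_semigroup H -> is_genus H (genus H).
Proof.
move=> [_ _ [s hs]]; apply: epsilon_spec.
pose d n := if excluded_middle_informative (H n) then false else true.
exists (size (undup (filter d s))), (undup (filter d s)).
split=> [|n|//]; first exact: undup_uniq.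
rewrite mem_undup mem_filter /d.
case: excluded_middle_informative => Hn /=; first by split.
by split=> // _; apply: hs.
Qed.

(* Main.v *)
Require Import Defs.
From mathcomp Require Import all_boot all_order all_algebra.
From mathcomp Require Import mpoly.
From mathcomp Require Import zify ring.
From Stdlib Require Import Classical.
Set Implicit Arguments.
Unset Strict Implicit.
Unset Printing Implicit Defensive.
Import Order.TTheory GRing.Theory Num.Theory.
Local Open Scope ring_scope.

(** The theorem comes from an explicit description of the Apery set of [H]
    with respect to [a], i.e. of the least element of [H] in each residue class
    modulo [a].

    Read each maximal minor as a rewriting rule which trades a monomial in
    [Y, Z] for one containing more [X]:
      Y^(be+be') -> X^al Z^ga',  Z^(ga+ga') -> X^al' Y^be,
      Y^be' Z^ga -> X^(al+al').
    Since the minors lie in the kernel of [phi], the rules preserve the weight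
    (the exponent of [t]), and since they raise the exponent of [X] they
    terminate ([semigroup_stair]).  The irreducible monomials [X^i Y^j Z^l] are
    those whose [(j, l)] lies in the L-shaped staircase [stair].  Conversely,
    two such monomials of the same weight coincide ([stair_weight_inj]): cancel
    their common power of [X]; the difference lies in the ideal of minors, and
    setting [X = 0] turns this ideal into the monomial ideal
    (Y^(be+be'), Y^be' Z^ga, Z^(ga+ga')), which contains no [Y^j Z^l] with
    [(j, l)] in the staircase.

    Hence the numbers [j b + l c], for [(j, l)] in the staircase, form the Apery
    set ([stairs_residues], [mem_semigroup_stairs]), and [a] is the area of the
    staircase ([stairs_count]).  By the formulas of Selmer and of Brauer and
    Shockley, the genus is determined by the sum of the Apery set, and
    F(H) + a is its largest element.  That element is the weight of one of the
    two outer corners, (be'-1, ga+ga'-1) and (be+be'-1, ga-1), and by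
    the degree relations the first outweighs the second by be' b - al a; this is
    why the answer depends on the comparison of these two numbers. *)

(** * Genus and Frobenius number from an Apery set *)

Lemma modn_mulDr n t a : (n + t * a = n %[mod a])%N.
Proof. by rewrite addnC modnMDl. Qed.

Section Apery.
Variables (H : nat -> Prop) (a : nat) (A : seq nat).
Hypothesis a_gt0 : (0 < a)%N.
Hypothesis residuesA : perm_eq [seq w %% a | w <- A]%N (iota 0 a).
Hypothesis memH :
  forall n, H n <-> exists2 w, w \in A & exists t, n = (w + t * a)%N.

Lemma apery_mod_inj : {in A &, injective (fun w => w %% a)%N}.
Proof.
have uA : uniq [seq w %% a | w <- A]%N by rewrite (perm_uniq residuesA) iota_uniq.
move=> u v Au Av eq_uv; rewrite -(nth_index 0%N Au) -(nth_index 0%N Av).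
congr (nth _ _ _); apply/eqP; rewrite -(nth_uniq 0%N _ _ uA) ?size_map ?index_mem //.
by rewrite !(nth_map 0%N) ?index_mem // !nth_index ?eq_uv.
Qed.

(** In each residue class, the members of [H] are the numbers from the Apery
    element on, so the gaps are the numbers below it. *)
Lemma apery_gapP n :
  ~ H n <-> exists2 w, w \in A & exists s, w = (n + s.+1 * a)%N.
Proof.
split=> [nHn | [w Aw [s def_w]] /memH[w' Aw' [t def_n]]].
  have: (n %% a)%N \in [seq w %% a | w <- A]%N.
    by rewrite (perm_mem residuesA) mem_iota ltn_mod.
  case/mapP=> w Aw eq_mod; exists w => //.
  have [le_wn | lt_nw] := leqP w n.
    case: nHn; apply/memH; exists w => //; exists ((n - w) %/ a)%N.
    by rewrite divnK -?eqn_mod_dvd ?eq_mod // subnKC.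
  have /dvdnP[[|s] def_w]: (a %| w - n)%N.
    by rewrite -eqn_mod_dvd ?(ltnW lt_nw) ?eq_mod.
    by move: lt_nw; rewrite -subn_gt0 def_w.
  by exists s; rewrite -def_w subnKC // ltnW.
have eq_w : w = w'.
  by apply: apery_mod_inj; rewrite // def_w def_n !modn_mulDr.
by move: def_n; rewrite -eq_w def_w; nia.
Qed.

(** Subtracting [a] from the Apery element of a class gives the largest integer
    of that class outside [H]. *)
Lemma apery_is_frobenius M :
  M \in A -> (forall w, w \in A -> w <= M)%N -> is_frobenius H (M%:Z - a%:Z).
Proof.
move=> AM maxM; split=> [[n def_n] | [n | n] gap_n].
- suff: ~ H n by [].
  by apply/apery_gapP; exists M => //; exists 0%N; lia.
- have /apery_gapP[w /maxM le_wM [s def_w]] : ~ H n.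
    by move=> Hn; apply: gap_n; exists n.
  by rewrite -[Posz n]/(n%:Z); nia.
(* A negative integer is at most [M - a], because the Apery element of the
   class of [a - 1] is at least [a - 1]. *)
have: a.-1 \in [seq w %% a | w <- A]%N.
  by rewrite (perm_mem residuesA) mem_iota /= add0n prednK.
case/mapP=> w /maxM le_wM def_a; have := leq_mod w a; lia.
Qed.

(** The Apery element [w] has [w %/ a] gaps below it in its class. *)
Lemma apery_is_genus : is_genus H (\sum_(w <- A) w %/ a)%N.
Proof.
exists [seq (w - t.+1 * a)%N | w <- A, t <- iota 0 (w %/ a)]; split.
- apply: allpairs_uniq_dep => [|w _|]; rewrite ?iota_uniq //.
    apply: (@map_uniq _ _ (fun w => w %% a)%N).
    by rewrite (perm_uniq residuesA) iota_uniq.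
  move=> _ _ /allpairsPdep[w [t [Aw t_w ->]]] /allpairsPdep[v [s [Av s_v ->]]] /=.
  move: t_w s_v; rewrite !mem_iota /= => t_w s_v eq_gap.
  have le_w : (t.+1 * a <= w)%N by rewrite -leq_divRL //; lia.
  have le_v : (s.+1 * a <= v)%N by rewrite -leq_divRL //; lia.
  have eq_wv : w = v.
    apply: apery_mod_inj => //=.
    by rewrite -(subnK le_w) -(subnK le_v) eq_gap !modn_mulDr.
  subst v; congr Tagged; nia.
- move=> n; rewrite apery_gapP; split.
    case/allpairsPdep=> w [t [Aw]]; rewrite mem_iota /= add0n => lt_t ->.
    exists w => //; exists t; rewrite subnK //.
    by rewrite -leq_divRL.
  case=> w Aw [s def_w]; apply/allpairsPdep; exists w, s; split=> //.
    by rewrite mem_iota /= add0n leq_divRL // def_w leq_addl.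
  by rewrite def_w addnK.
rewrite size_allpairs_dep sumnE big_map.
by apply: eq_bigr => w _; rewrite size_iota.
Qed.

(** Since the remainders of the Apery elements are 0, ..., a-1, the sum of the
    quotients [w %/ a] is determined by the sum of the [w]. *)
Lemma apery_genus_sum g :
  is_genus H g -> (2 * a * g + a * a.-1 = 2 * \sum_(w <- A) w)%N.
Proof.
move/is_genus_uniq/(_ apery_is_genus)->.
have sum_mod : (\sum_(w <- A) w %% a = 'C(a, 2))%N.
  by rewrite -bin2_sum /index_iota subn0 -(perm_big _ residuesA) big_map.
rewrite [in RHS](eq_bigr _ (fun w _ => divn_eq w a)) big_split /= -big_distrl /=.
by rewrite sum_mod mulnDr -mul_bin_diag bin1 mulnA mulnAC.
Qed.
End Apery.

(** * Monomials in three variables and the minors *)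

Lemma mem_semigroup_gen3 a b c n :
  semigroup_gen [:: a; b; c] n <->
  exists i j l, n = (i * a + j * b + l * c)%N.
Proof.
split=> [[x ->] | [i [j [l ->]]]].
  by do 3 eexists; rewrite !big_ord_recl big_ord0 /= addn0 addnA.
exists (fun q => nth 0 [:: i; j; l] q)%N.
by rewrite !big_ord_recl big_ord0 /= addn0 addnA.
Qed.

Definition mon3 (i j l : nat) : 'X_{1..3} :=
  [multinom nth 0 [:: i; j; l] q | q < 3]%N.

Lemma mon3_le i j l i' j' l' :
  (mon3 i j l <= mon3 i' j' l')%MM = [&& i <= i', j <= j' & l <= l']%N.
Proof.
apply/mnm_lepP/and3P=> [le_m | [le_i le_j le_l] [[|[|[|q]]] lt_q] //].
  have := (le_m (@Ordinal 3 0 isT), le_m (@Ordinal 3 1 isT), le_m (@Ordinal 3 2 isT)).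
  by rewrite !mnmE /= => -[[]].
all: by rewrite !mnmE.
Qed.

Lemma mon3_inj i j l i' j' l' :
  mon3 i j l = mon3 i' j' l' -> [/\ i = i', j = j' & l = l'].
Proof.
move/mnmP=> eq_m.
have := (eq_m (@Ordinal 3 0 isT), eq_m (@Ordinal 3 1 isT), eq_m (@Ordinal 3 2 isT)).
by rewrite !mnmE /= => -[[]].
Qed.

Lemma mpolyX_mon3 (k : fieldType) i j l :
  'X_[mon3 i j l] = varX k ^+ i * varY k ^+ j * varZ k ^+ l.
Proof.
rewrite /varX /varY /varZ !mpolyXn -!mpolyXD; congr mpolyX.
apply/mnmP=> -[[|[|[|q]]] lt_q] //; rewrite !(mnmE, mnmDE, mulmnE, mnm1E) /= ?mul0n ?mul1n; lia.
Qed.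

Lemma phi_mon3 (k : fieldType) a b c i j l :
  phi a b c ('X_[mon3 i j l] : {mpoly k[3]}) = 'X^(i * a + j * b + l * c).
Proof.
rewrite /phi mmapX /mmap1 !big_ord_recl big_ord0 /= !mnmE /= mulr1.
by rewrite -!exprM -!exprD addnA ![(_ * i)%N]mulnC ![(_ * j)%N]mulnC ![(_ * l)%N]mulnC.
Qed.

Lemma phi_binomial (k : fieldType) a b c i j l i' j' l' :
  phi a b c ('X_[mon3 i j l] - 'X_[mon3 i' j' l'] : {mpoly k[3]}) = 0 <->
  (i * a + j * b + l * c = i' * a + j' * b + l' * c)%N.
Proof.
have -> p q : phi a b c (p - q) = phi a b c p - phi a b c q :> {poly k}.
  exact: raddfB.
rewrite !phi_mon3; split=> [/eqP | ->]; last exact: subrr.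
rewrite subr_eq0 => /eqP eq_X.
by have := congr1 (fun p : {poly k} => size p) eq_X; rewrite !size_polyXn => -[].
Qed.

Lemma mcoeff_mulX_notle n (R : nzRingType) (u : {mpoly R[n]}) (m m' : 'X_{1..n}) :
  ~~ (m <= m')%MM -> (u * 'X_[m])@_m' = 0.
Proof.
move=> nle; apply: memN_msupp_eq0; rewrite (perm_mem (msuppMX _ _)).
by apply: contra nle => /mapP[d _ ->]; apply: lem_addr.
Qed.

Lemma det_mx22 (R : comNzRingType) (A : 'M[R]_2) :
  \det A = A 0 0 * A 1 1 - A 0 1 * A 1 0.
Proof.
rewrite (expand_det_row _ 0) !big_ord_recl big_ord0 addr0 /cofactor !det_mx11 !mxE /=.
rewrite expr0 expr1 mul1r mulN1r mulrN.
by congr (_ * A _ _ - A _ _ * A _ _); apply: val_inj.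
Qed.

Lemma max_minorE (k : fieldType) (al be ga al' be' ga' : nat) (j : 'I_3) :
  max_minor (herzog_matrix k al be ga al' be' ga') j = nth 0
    [:: 'X_[mon3 al' be 0] - 'X_[mon3 0 0 (ga + ga')];
        'X_[mon3 (al + al') 0 0] - 'X_[mon3 0 be' ga];
        'X_[mon3 al 0 ga'] - 'X_[mon3 0 (be + be') 0]] j.
Proof.
rewrite /max_minor det_mx22 !mxE /=.
case: j => [[|[|[|j]]] lt_j] //=; rewrite !mpolyX_mon3 ?exprD; ring.
Qed.

Lemma ideal_gen_generator (R : comNzRingType) (I : finType) (g : I -> R) i :
  ideal_gen g (g i).
Proof.
exists (fun i' => (i' == i)%:R).
rewrite (bigD1 i) //= eqxx mul1r big1 ?addr0 // => i' /negPf->.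
by rewrite mul0r.
Qed.

(** * The staircase of irreducible exponents *)

Definition stair (be ga be' ga' j l : nat) :=
  [&& j < be + be', l < ga + ga' & (j < be') || (l < ga)]%N.

(** Modulo [X] each minor is a single monomial up to sign, and none of the three
    monomials obtained divides a [Y^j Z^l] of the staircase. *)
Lemma mcoeff_stair (k : fieldType) (al be ga al' be' ga' j l : nat) p :
  (0 < al)%N -> (0 < al')%N ->
  ideal_gen (max_minor (herzog_matrix k al be ga al' be' ga')) p ->
  stair be ga be' ga' j l -> p@_(mon3 0 j l) = 0.
Proof.
move=> al_gt0 al'_gt0 [u ->] /and3P[lt_j lt_l corner].
rewrite raddf_sum big1 // => q _; rewrite max_minorE.
case: q => [[|[|[|q]]] lt_q] //=;
  rewrite mulrBr mcoeffB !mcoeff_mulX_notle ?subrr ?mon3_le //; lia.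
Qed.

Definition rect (m q r : nat) : seq (nat * nat) :=
  [seq (j, l) | j <- iota m q, l <- iota 0 r].

(** The L shape [stair] is cut along [j = be'] into two rectangles, over which
    weights are summed in closed form. *)
Definition stairs (be ga be' ga' : nat) : seq (nat * nat) :=
  rect 0 be' (ga + ga') ++ rect be' be ga.

Definition stair_weights (b c be ga be' ga' : nat) : seq nat :=
  [seq (p.1 * b + p.2 * c)%N | p <- stairs be ga be' ga'].

Lemma mem_rect m q r j l :
  ((j, l) \in rect m q r) = (m <= j < m + q)%N && (l < r)%N.
Proof.
apply/allpairsP/andP=> [[[j' l'] /= []] | [j_q l_r]].
  by rewrite !mem_iota => j_q l_r [-> ->].
by exists (j, l); rewrite !mem_iota.
Qed.

Lemma rect_uniq m q r : uniq (rect m q r).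
Proof. by apply: allpairs_uniq; rewrite ?iota_uniq // => -[? ?] [? ?] _ _ [-> ->]. Qed.

(** Doubling and moving the linear term to the left keep the arithmetic
    progressions within the natural numbers. *)
Lemma rect_weight_sum b c m q r :
  (2 * (\sum_(p <- rect m q r) (p.1 * b + p.2 * c)) + (b + c) * (q * r) =
   r * b * (q * (2 * m + q)) + q * c * (r * r))%N.
Proof.
have col_sum x s p : (2 * (\sum_(l <- iota s p) (x + l * c)) + c * p =
    p * (2 * x) + c * (p * (2 * s + p)))%N.
  elim: p s => [|p IHp] s; first by rewrite big_nil; lia.
  by rewrite big_cons; have := IHp s.+1; move: (\sum_(l <- _) _)%N => w; nia.
elim: q m => [|q IHq] m; first by rewrite /rect big_nil; lia.
rewrite /rect /= big_cat /= big_map /= -/(rect _ _ _).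
have := IHq m.+1; have := col_sum (m * b)%N 0%N r; lia.
Qed.

Lemma mem_stairs be ga be' ga' j l :
  ((j, l) \in stairs be ga be' ga') = stair be ga be' ga' j l.
Proof. by rewrite mem_cat !mem_rect /stair; lia. Qed.

Lemma stairs_uniq be ga be' ga' : uniq (stairs be ga be' ga').
Proof.
rewrite cat_uniq !rect_uniq andbT /=; apply/hasPn=> -[j l].
by rewrite !mem_rect; lia.
Qed.

Lemma stairs_size be ga be' ga' :
  size (stairs be ga be' ga') = (be' * (ga + ga') + be * ga)%N.
Proof. by rewrite size_cat !size_allpairs !size_iota. Qed.

Lemma numerical_semigroup_residue H a r : (0 < a)%N -> numerical_semigroup H ->
  exists N, H (r + N * a)%N.
Proof.
move=> a_gt0 [_ _ [s gaps]]; exists (\max_(x <- s) x).+1.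
apply: NNPP => /gaps s_n.
have := @leq_bigmax_seq _ s xpredT id _ s_n isT.
by move: (\max_(_ <- _) _)%N => m /=; nia.
Qed.

Lemma predn_mulD m n : (0 < m)%N -> (m.-1 * n + n = m * n)%N.
Proof. by case: m => // m _; rewrite mulSn addnC. Qed.

(** * The Apery set of a monomial curve *)

Section Staircase.
Variables (k : fieldType) (a b c al be ga al' be' ga' : nat).
Hypotheses (a_gt0 : (0 < a)%N) (al_gt0 : (0 < al)%N) (al'_gt0 : (0 < al')%N).
Hypothesis ker_phi : forall p : {mpoly k[3]},
  phi a b c p = 0 <->
  ideal_gen (max_minor (herzog_matrix k al be ga al' be' ga')) p.
Hypothesis numH : numerical_semigroup (semigroup_gen [:: a; b; c]).

Lemma weight_minors :
  [/\ al' * a + be * b = (ga + ga') * c,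
      (al + al') * a = be' * b + ga * c
    & al * a + ga' * c = (be + be') * b]%N.
Proof.
have ker_minor q := proj2 (ker_phi _)
  (ideal_gen_generator (max_minor (herzog_matrix k al be ga al' be' ga')) q).
split.
- have := ker_minor (@Ordinal 3 0 isT); rewrite max_minorE /= phi_binomial; lia.
- have := ker_minor (@Ordinal 3 1 isT); rewrite max_minorE /= phi_binomial; lia.
- have := ker_minor (@Ordinal 3 2 isT); rewrite max_minorE /= phi_binomial; lia.
Qed.

(** After removal of the common power of [X], one of the two monomials is free
    of [X]; its coefficient in the difference vanishes by [mcoeff_stair], so the
    other monomial must cancel it. *)
Lemma stair_weight_inj i j l i' j' l' :
  stair be ga be' ga' j l -> stair be ga be' ga' j' l' ->
  (i * a + j * b + l * c = i' * a + j' * b + l' * c)%N ->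
  [/\ i = i', j = j' & l = l'].
Proof.
wlog le_ii' : i j l i' j' l' / (i <= i')%N.
  move=> wlog_le st st' eq_w; have [le_ii' | /ltnW le_i'i] := leqP i i'.
    exact: wlog_le.
  by have [] := wlog_le _ _ _ _ _ _ le_i'i st' st (esym eq_w).
move=> st _ eq_w.
have /(mcoeff_stair al_gt0 al'_gt0)/(_ st): ideal_gen
    (max_minor (herzog_matrix k al be ga al' be' ga'))
    ('X_[mon3 0 j l] - 'X_[mon3 (i' - i) j' l']).
  by apply/ker_phi/phi_binomial; nia.
rewrite mcoeffB !mcoeffX eqxx; case: eqP => [/mon3_inj[] | _ /eqP].
  by move=> d0 -> -> _; split=> //; lia.
by rewrite subr0 oner_eq0.
Qed.

(** Each rule raises the exponent [i] of [X] and preserves the weight [n], so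
    the induction is on [n - i]; the bound [i <= n] uses [0 < a]. *)
Lemma semigroup_stair n :
  semigroup_gen [:: a; b; c] n ->
  exists j l t, stair be ga be' ga' j l /\ n = (j * b + l * c + t * a)%N.
Proof.
have [E0 E1 E2] := weight_minors.
case/mem_semigroup_gen3=> i [j [l def_n]].
have [m] := ubnP (n - i); elim: m i j l def_n => // m IHm i j l def_n lt_m.
have le_in : (i <= n)%N by nia.
have reduce i' j' l' : (i < i')%N ->
    (i' * a + j' * b + l' * c = i * a + j * b + l * c)%N ->
    exists j l t, stair be ga be' ga' j l /\ n = (j * b + l * c + t * a)%N.
  move=> lt_ii' eq_w; apply: (IHm i' j' l'); first by rewrite eq_w.
  have : (i' <= n)%N by nia.
  by lia.
have [lt_j | ge_j] := ltnP j (be + be').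
  have [lt_l | ge_l] := ltnP l (ga + ga').
    have [corner | out] := boolP ((j < be') || (l < ga))%N.
      by exists j, l, i; rewrite /stair lt_j lt_l corner; split=> //; lia.
    apply: (reduce (i + (al + al')) (j - be') (l - ga))%N; nia.
  apply: (reduce (i + al') (j + be) (l - (ga + ga')))%N; nia.
apply: (reduce (i + al) (j - (be + be')) (l + ga'))%N; nia.
Qed.

Let A := stair_weights b c be ga be' ga'.

(** Two weights congruent modulo [a] become equal once suitable multiples of [a]
    are added, which [stair_weight_inj] forbids for distinct exponents. *)
Lemma stairs_residues : perm_eq [seq w %% a | w <- A]%N (iota 0 a).
Proof.
rewrite -map_comp; apply: uniq_perm; rewrite ?iota_uniq //.
  rewrite map_inj_in_uniq ?stairs_uniq // => -[j l] [j' l'].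
  rewrite !mem_stairs /= => st st' eq_mod.
  have [|_ -> ->] // := stair_weight_inj
    (i := (j' * b + l' * c) %/ a) (i' := (j * b + l * c) %/ a) st st' _.
  rewrite -!addnA [in LHS](divn_eq (j * b + l * c) a).
  by rewrite [in RHS](divn_eq (j' * b + l' * c) a) eq_mod; lia.
move=> r; rewrite mem_iota /= add0n; apply/mapP/idP=> [[w _ ->] | lt_ra].
  exact: ltn_pmod.
have [N] := numerical_semigroup_residue r a_gt0 numH.
case/semigroup_stair=> j [l [t [st eq_n]]].
exists (j, l); rewrite ?mem_stairs //=.
by rewrite -[LHS](modn_small lt_ra) -(modn_mulDr r N) eq_n modn_mulDr.
Qed.

Lemma mem_semigroup_stairs n : semigroup_gen [:: a; b; c] n <->
  exists2 w, w \in A & exists t, n = (w + t * a)%N.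
Proof.
split=> [|[_ /mapP[[j l] _ ->] [t ->]]].
  case/semigroup_stair=> j [l [t [st ->]]].
  exists (j * b + l * c)%N; last by exists t.
  by apply/mapP; exists (j, l); rewrite ?mem_stairs.
by apply/mem_semigroup_gen3; exists t, j, l; rewrite /=; lia.
Qed.

Lemma stairs_count : a = (be' * (ga + ga') + be * ga)%N.
Proof. by have := perm_size stairs_residues; rewrite !size_map stairs_size size_iota. Qed.

Lemma frobenius_stairs M : M \in A -> (forall w, w \in A -> w <= M)%N ->
  frobenius (semigroup_gen [:: a; b; c]) = M%:Z - a%:Z.
Proof.
move=> AM maxM; apply: is_frobenius_uniq (frobeniusP numH) _.
exact: (apery_is_frobenius a_gt0 stairs_residues mem_semigroup_stairs AM).
Qed.

Lemma genus_stairs : let g := genus (semigroup_gen [:: a; b; c]) in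
  (2 * a * g + a * a.-1 + (b + c) * a =
   (ga + ga') * b * (be' * be') + be' * c * ((ga + ga') * (ga + ga'))
   + ga * b * (be * (2 * be' + be)) + be * c * (ga * ga))%N.
Proof.
rewrite /= (apery_genus_sum a_gt0 stairs_residues mem_semigroup_stairs (genusP numH)).
rewrite [X in ((b + c) * X)%N]stairs_count big_map big_cat /=.
have := rect_weight_sum b c 0 be' (ga + ga'); have := rect_weight_sum b c be' be ga.
lia.
Qed.

(** * The two corners *)

(** Dividing [genus_stairs] by [a] needs one relation between the weights: the
    summands proportional to [be * ga] combine, by the degree relation of
    the minor without the third column, into [al * be * ga * a]. *)
Lemma genus_upper_corner :
  (2 * genus (semigroup_gen [:: a; b; c]) + a.-1 + b + c =
   be' * b + (ga + ga') * c + al * be * ga)%N.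
Proof.
have [_ _ E2] := weight_minors.
apply/eqP; rewrite -(eqn_pmul2l a_gt0); apply/eqP.
have := genus_stairs; move: (genus _) => g /= eq_g.
have -> : (a * (2 * g + a.-1 + b + c) = 2 * a * g + a * a.-1 + (b + c) * a)%N by lia.
have {}E2 := congr1 (muln (be * ga)) E2.
by rewrite eq_g !mulnDr; move: E2; rewrite stairs_count; lia.
Qed.

(** The same number written from the other corner, by the degree relation of
    the minor without the first column. *)
Lemma genus_lower_corner :
  (2 * genus (semigroup_gen [:: a; b; c]) + a.-1 + b + c =
   (be + be') * b + ga * c + al' * be' * ga')%N.
Proof.
have [E0 _ _] := weight_minors.
apply/eqP; rewrite -(eqn_pmul2l a_gt0); apply/eqP.
have := genus_stairs; move: (genus _) => g /= eq_g.
have -> : (a * (2 * g + a.-1 + b + c) = 2 * a * g + a * a.-1 + (b + c) * a)%N by lia.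
have {}E0 := congr1 (muln (be' * ga')) E0.
by rewrite eq_g !mulnDr; move: E0; rewrite stairs_count; lia.
Qed.

Hypotheses (be_gt0 : (0 < be)%N) (ga_gt0 : (0 < ga)%N).
Hypotheses (be'_gt0 : (0 < be')%N) (ga'_gt0 : (0 < ga')%N).

(** A weight of the staircase is at most that of an outer corner, and the minor
    without the third column gives (weight of the upper corner) - (weight of the
    lower corner) = be' b - al a. *)
Lemma frobenius_upper_corner : (al * a < be' * b)%N ->
  frobenius (semigroup_gen [:: a; b; c]) =
    (be' * b + (ga + ga') * c)%N%:Z - (a + b + c)%N%:Z.
Proof.
move=> lt_corner; have [_ _ E2] := weight_minors.
rewrite (@frobenius_stairs (be'.-1 * b + (ga + ga').-1 * c)).
- by rewrite -(predn_mulD b be'_gt0) -(@predn_mulD (ga + ga') c); lia.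
- by apply/mapP; exists (be'.-1, (ga + ga').-1); rewrite // mem_stairs /stair; lia.
move=> _ /mapP[[j l] + ->] /=.
rewrite mem_stairs /stair => /and3P[lt_j lt_l /orP[lt_j' | lt_l']].
  by rewrite leq_add // leq_mul //; lia.
have le_w : (j * b + l * c <= (be + be').-1 * b + ga.-1 * c)%N.
  by rewrite leq_add // leq_mul //; lia.
apply: leq_trans le_w _.
have := (predn_mulD b be'_gt0, @predn_mulD (ga + ga') c,
         @predn_mulD (be + be') b, predn_mulD c ga_gt0).
rewrite !addn_gt0 be_gt0 ga_gt0 => -[[[]]] + /(_ isT) + /(_ isT); lia.
Qed.

Lemma frobenius_lower_corner : (be' * b < al * a)%N ->
  frobenius (semigroup_gen [:: a; b; c]) =
    ((be + be') * b + ga * c)%N%:Z - (a + b + c)%N%:Z.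
Proof.
move=> lt_corner; have [_ _ E2] := weight_minors.
rewrite (@frobenius_stairs ((be + be').-1 * b + ga.-1 * c)).
- by rewrite -(predn_mulD c ga_gt0) -(@predn_mulD (be + be') b); lia.
- by apply/mapP; exists ((be + be').-1, ga.-1); rewrite // mem_stairs /stair; lia.
move=> _ /mapP[[j l] + ->] /=.
rewrite mem_stairs /stair => /and3P[lt_j lt_l /orP[lt_j' | lt_l']]; last first.
  by rewrite leq_add // leq_mul //; lia.
have le_w : (j * b + l * c <= be'.-1 * b + (ga + ga').-1 * c)%N.
  by rewrite leq_add // leq_mul //; lia.
apply: leq_trans le_w _.
have := (predn_mulD b be'_gt0, @predn_mulD (ga + ga') c,
         @predn_mulD (be + be') b, predn_mulD c ga_gt0).
rewrite !addn_gt0 be_gt0 ga_gt0 => -[[[]]] + /(_ isT) + /(_ isT); lia.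
Qed.

End Staircase.

Theorem theorem3p2
  (a b c : nat) (ha : (0 < a)%N) (hb : (0 < b)%N) (hc : (0 < c)%N)
  (hH : numerical_semigroup (semigroup_gen [:: a; b; c]))
  (hns : ~ symmetric_semigroup (semigroup_gen [:: a; b; c]))
  (k : fieldType) (al be ga al' be' ga' : nat)
  (hal : (0 < al)%N) (hbe : (0 < be)%N) (hga : (0 < ga)%N)
  (hal' : (0 < al')%N) (hbe' : (0 < be')%N) (hga' : (0 < ga')%N)
  (hker : forall p : {mpoly k[3]},
     phi a b c p = 0 <->
     ideal_gen (max_minor (herzog_matrix k al be ga al' be' ga')) p) :
  let H := semigroup_gen [:: a; b; c] in
  ((be' * b > al * a)%N ->
     2 * (genus H)%:Z - (frobenius H + 1) = (al * be * ga)%N%:Z) /\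
  ((be' * b < al * a)%N ->
     2 * (genus H)%:Z - (frobenius H + 1) = (al' * be' * ga')%N%:Z).
Proof.
split=> lt_corner.
  rewrite (frobenius_upper_corner ha hal hal' hker hH) //.
  by have := genus_upper_corner ha hal hal' hker hH; lia.
rewrite (frobenius_lower_corner ha hal hal' hker hH) //.
by have := genus_lower_corner ha hal hal' hker hH; lia.
Qed.
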